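(* Let $S$ be a totally umbilical PAInv-submanifold of a Kenmotsu space form $\bar M(c)$, with ambiguous distribution $\mathfrak D$, anti-invariant distribution $\mathfrak D^\perp$ and mean curvature vector $\mathcal H$. Then at least one of the following statements holds: (i) $S$ is a totally geodesic submanifold of $\bar M(c)$; (ii) the mean curvature vector satisfies $\mathcal H\in\Gamma(N\mathfrak D\oplus\mu)$; (iii) if $\mathcal H\in\Gamma(\phi\mathfrak D^\perp)$, then $\dim(\mathfrak D^\perp)=1$.
   Context: An almost contact metric manifold $(\bar M,\phi,\xi,\eta,g)$ is a Riemannian manifold $(\bar M,g)$ of dimension $2n+1$ with a $(1,1)$-tensor field $\phi$, a vector field $\xi$ and a 1-form $\eta$ such that $\phi^2=-I+\eta\otimes\xi$, $\eta(\xi)=1$, $\phi\xi=0$, $\eta\circ\phi=0$ and $g(\phi X,\phi Y)=g(X,Y)-\eta(X)\eta(Y)$. It is a Kenmotsu manifold if its Levi-Civita connection $\bar\nabla$ satisfies $(\bar\nabla_X\phi)Y=g(\phi X,Y)\xi-\eta(Y)\phi X$ (hence $\bar\nabla_X\xi=X-\eta(X)\xi$). A Kenmotsu space form $\bar M(c)$ is a Kenmotsu manifold of constant $\phi$-sectional curvature $c$; its curvature tensor is $\tilde R(X,Y)Z=\frac{c-3}{4}\{g(Y,Z)X-g(X,Z)Y\}+\frac{c+1}{4}[\eta(X)\eta(Z)Y-\eta(Y)\eta(Z)X+g(X,Z)\eta(Y)\xi-g(Y,Z)\eta(X)\xi+g(\phi Y,Z)\phi X-g(\phi X,Z)\phi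 Y-2g(\phi X,Y)\phi Z]$. Let $S$ be an immersed submanifold of $\bar M$ with $\xi$ tangent to $S$. For $X$ tangent to $S$ write $\phi X=TX+NX$ with $TX$ tangent and $NX$ normal to $S$. $S$ is a PAInv-submanifold (partially anti-invariant submanifold) if there are mutually orthogonal distributions $\mathfrak D$ (the ambiguous distribution) and $\mathfrak D^\perp$ on $S$ with orthogonal decomposition $TS=\mathfrak D\oplus\mathfrak D^\perp\oplus\langle\xi\rangle$, $\phi\mathfrak D^\perp\subseteq TS^\perp$ ($\mathfrak D^\perp$ is anti-invariant) and $T\mathfrak D\subseteq\mathfrak D$. The normal bundle decomposes orthogonally as $TS^\perp=\phi\mathfrak D^\perp\oplus N\mathfrak D\oplus\mu$, where $\mu$ is the orthogonal complementary subbundle of $\phi\mathfrak D^\perp\oplus N\mathfrak D$. With $h$ the second fundamental form of $S$, $S$ is totally umbilical if $h(Z,W)=g(Z,W)\mathcal H$ for all $Z,W\in\Gamma(TS)$, and totally geodesic if $h=0$. *)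

(* Defs.v *)
From HB Require Import structures.
From mathcomp Require Import all_boot all_order all_algebra.
From mathcomp Require Import all_classical all_reals all_analysis.

Set Implicit Arguments.
Unset Strict Implicit.
Unset Printing Implicit Defensive.

Import Order.TTheory GRing.Theory Num.Theory.
Import numFieldNormedType.Exports.

Local Open Scope classical_set_scope.
Local Open Scope ring_scope.

(* For U open, all iterated partial derivatives of f being (Frechet)
   differentiable on U is the same as f being C^oo on U. *)
Definition smooth_on (R : realType) (n : nat) (U : set 'rV[R]_n)
    (f : 'rV[R]_n -> R) : Prop :=
  forall (s : seq 'I_n) (x : 'rV[R]_n), U x ->
    differentiable
      (foldr (fun i (g : 'rV[R]_n -> R^o) y => 'D_(delta_mx 0 i) g y) f s
        : 'rV[R]_n -> R^o) x.

(* Second countable Hausdorff spaces with a smooth atlas. [param i] is only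
   meaningful on the coordinate patch [coord i @` dom i]. *)
Record manifold (R : realType) (n : nat) := Manifold {
  carrier :> topologicalType;
  chart : Type;
  dom : chart -> set carrier;
  coord : chart -> carrier -> 'rV[R]_n;
  param : chart -> 'rV[R]_n -> carrier;
  manifold_hausdorff : hausdorff_space carrier;
  manifold_second_countable : @second_countable carrier;
  dom_cover : forall p, exists i, dom i p;
  dom_open : forall i, open (dom i);
  patch_open : forall i, open (coord i @` dom i);
  coordK : forall i p, dom i p -> param i (coord i p) = p;
  coord_continuous : forall i p, dom i p -> {for p, continuous (coord i)};
  param_continuous : forall i x, (coord i @` dom i) x ->
    {for x, continuous (param i)};
  transition_smooth : forall i j k,
    smooth_on (coord i @` (dom i `&` dom j))
              (fun x => coord j (param i x) 0 k)
}.

Section TangentSpaces.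
Variables (R : realType) (n : nat) (M : manifold R n).

Definition smooth_fun (f : M -> R) : Prop :=
  forall i : chart M, smooth_on (coord i @` dom i) (fun x => f (param i x)).

(* Tangent vectors are derivations of the algebra of smooth functions, encoded
   as functionals on all functions that vanish off the smooth ones, so that
   equality of tangent vectors is equality of functionals and the vector space
   operations are those of functions. *)
Definition functional : Type := (M -> R) -> R.

HB.instance Definition _ := GRing.Lmodule.on functional.

Record tangent (p : M) (v : functional) : Prop := {
  tangent_off : forall f, ~ smooth_fun f -> v f = 0;
  tangent_linear : forall (a : R) f f', smooth_fun f -> smooth_fun f' ->
    v (fun q => a * f q + f' q) = a * v f + v f';
  tangent_leibniz : forall f f', smooth_fun f -> smooth_fun f' ->
    v (fun q => f q * f' q) = f p * v f' + f' p * v f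
}.

Definition field : Type := M -> functional.

Definition vector_field (X : field) : Prop :=
  (forall p, tangent p (X p)) /\
  (forall f, smooth_fun f -> smooth_fun (fun p => X p f)).

Definition lie_bracket (X Y : field) : field :=
  fun p f => X p (fun q => Y q f) - Y p (fun q => X q f).

Record one_form (eta : M -> functional -> R) : Prop := {
  one_form_linear : forall p (a : R) v w, tangent p v -> tangent p w ->
    eta p (a *: v + w) = a * eta p v + eta p w;
  one_form_smooth : forall X, vector_field X ->
    smooth_fun (fun p => eta p (X p))
}.

Record endomorphism_field (phi : M -> functional -> functional) : Prop := {
  endo_tangent : forall p v, tangent p v -> tangent p (phi p v);
  endo_linear : forall p (a : R) v w, tangent p v -> tangent p w ->
    phi p (a *: v + w) = a *: phi p v + phi p w;
  endo_smooth : forall X, vector_field X -> vector_field (fun p => phi p (X p))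
}.

Record riemannian_metric (g : M -> functional -> functional -> R) : Prop := {
  riem_sym : forall p v w, tangent p v -> tangent p w -> g p v w = g p w v;
  riem_linear : forall p (a : R) u v w,
    tangent p u -> tangent p v -> tangent p w ->
    g p (a *: u + v) w = a * g p u w + g p v w;
  riem_pos : forall p v, tangent p v -> v <> 0 -> 0 < g p v v;
  riem_smooth : forall X Y, vector_field X -> vector_field Y ->
    smooth_fun (fun p => g p (X p) (Y p))
}.

Record levi_civita (g : M -> functional -> functional -> R)
    (D : field -> field -> field) : Prop := {
  lc_field : forall X Y, vector_field X -> vector_field Y ->
    vector_field (D X Y);
  lc_linear : forall f X X' Y, smooth_fun f ->
    vector_field X -> vector_field X' -> vector_field Y ->
    D (fun p => f p *: X p + X' p) Y = (fun p => f p *: D X Y p + D X' Y p);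
  lc_additive : forall X Y Y',
    vector_field X -> vector_field Y -> vector_field Y' ->
    D X (fun p => Y p + Y' p) = (fun p => D X Y p + D X Y' p);
  lc_leibniz : forall f X Y, smooth_fun f ->
    vector_field X -> vector_field Y ->
    D X (fun p => f p *: Y p) = (fun p => X p f *: Y p + f p *: D X Y p);
  lc_torsion_free : forall X Y p, vector_field X -> vector_field Y ->
    D X Y p - D Y X p = lie_bracket X Y p;
  lc_metric : forall X Y Z p,
    vector_field X -> vector_field Y -> vector_field Z ->
    X p (fun q => g q (Y q) (Z q)) = g p (D X Y p) (Z p) + g p (Y p) (D X Z p)
}.

Definition curvature (D : field -> field -> field) (X Y Z : field) : field :=
  fun p => D X (D Y Z) p - D Y (D X Z) p - D (lie_bracket X Y) Z p.

Definition sectional_curvature (g : M -> functional -> functional -> R)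
    (D : field -> field -> field) (X Y : field) (p : M) : R :=
  g p (curvature D X Y Y p) (X p) /
  (g p (X p) (X p) * g p (Y p) (Y p) - g p (X p) (Y p) ^+ 2).

(* A rank-[rank] smooth subbundle of the tangent bundle. Global vector fields
   suffice as local frames, by means of bump functions. *)
Record tangent_distribution := TangentDistribution {
  fiber :> M -> set functional;
  rank : nat;
  distribution_frame : forall p : M, exists E : 'I_rank -> field,
    (forall k, vector_field (E k)) /\
    (\forall q \near p,
      (forall a : 'I_rank -> R, \sum_k a k *: E k q = 0 -> forall k, a k = 0) /\
      fiber q = [set v | exists a : 'I_rank -> R, v = \sum_k a k *: E k q])
}.

End TangentSpaces.

Record almost_contact_metric (R : realType) (n : nat)
    (M : manifold R (2 * n).+1)
    (phi : M -> functional M -> functional M) (xi : field M)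
    (eta : M -> functional M -> R)
    (g : M -> functional M -> functional M -> R) : Prop := {
  acm_phi : endomorphism_field phi;
  acm_xi : vector_field xi;
  acm_eta : one_form eta;
  acm_g : riemannian_metric g;
  acm_phi2 : forall p v, tangent p v -> phi p (phi p v) = - v + eta p v *: xi p;
  acm_eta_xi : forall p, eta p (xi p) = 1;
  acm_phi_xi : forall p, phi p (xi p) = 0;
  acm_eta_phi : forall p v, tangent p v -> eta p (phi p v) = 0;
  acm_compat : forall p v w, tangent p v -> tangent p w ->
    g p (phi p v) (phi p w) = g p v w - eta p v * eta p w
}.

(* D is the Levi-Civita connection; the last clause is
   (D_X phi) Y = g(phi X, Y) xi - eta(Y) phi X. *)
Record kenmotsu (R : realType) (n : nat) (M : manifold R (2 * n).+1)
    (phi : M -> functional M -> functional M) (xi : field M)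
    (eta : M -> functional M -> R)
    (g : M -> functional M -> functional M -> R)
    (D : field M -> field M -> field M) : Prop := {
  kenmotsu_acm : almost_contact_metric phi xi eta g;
  kenmotsu_connection : levi_civita g D;
  kenmotsu_phi : forall X Y p, vector_field X -> vector_field Y ->
    D X (fun q => phi q (Y q)) p - phi p (D X Y p) =
    g p (phi p (X p)) (Y p) *: xi p - eta p (Y p) *: phi p (X p)
}.

(* A phi-section at p is a plane spanned by v and phi v, with v nonzero and
   orthogonal to xi. *)
Record kenmotsu_space_form (R : realType) (n : nat) (M : manifold R (2 * n).+1)
    (phi : M -> functional M -> functional M) (xi : field M)
    (eta : M -> functional M -> R)
    (g : M -> functional M -> functional M -> R)
    (D : field M -> field M -> field M) (c : R) : Prop := {
  space_form_kenmotsu : kenmotsu phi xi eta g D;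
  space_form_curvature : forall X p, vector_field X ->
    X p <> 0 -> g p (X p) (xi p) = 0 ->
    sectional_curvature g D X (fun q => phi q (X q)) p = c
}.

Section Submanifolds.
Variables (R : realType) (m n : nat) (S : manifold R m) (M : manifold R n).
Variable iota : S -> M.

Definition smooth_map : Prop :=
  continuous iota /\
  forall (i : chart S) (j : chart M) (k : 'I_n),
    smooth_on (coord i @` (dom i `&` (iota @^-1` dom j)))
              (fun x => coord j (iota (param i x)) 0 k).

Definition tangent_map (v : functional S) : functional M :=
  fun f => if `[< smooth_fun f >] then v (f \o iota) else 0.

Definition immersion : Prop :=
  smooth_map /\
  (forall p v w, tangent p v -> tangent p w ->
    tangent_map v = tangent_map w -> v = w).

Variable g : M -> functional M -> functional M -> R.

Definition induced_metric (p : S) (v w : functional S) : R :=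
  g (iota p) (tangent_map v) (tangent_map w).

Definition normal (p : S) (w : functional M) : Prop :=
  tangent (iota p) w /\
  forall v, tangent p v -> g (iota p) w (tangent_map v) = 0.

(* Components of w in the orthogonal sum of the tangent and normal spaces of
   S at p; the tangential one is a vector of S. *)
Definition tangential_part (p : S) (w : functional M) : functional S :=
  xget 0 [set v | tangent p v /\ normal p (w - tangent_map v)].

Definition normal_part (p : S) (w : functional M) : functional M :=
  w - tangent_map (tangential_part p w).

Definition local_extension (p : S) (X : field S) (X' : field M) : Prop :=
  vector_field X' /\ \forall q \near p, X' (iota q) = tangent_map (X q).

(* h(X, Y) is the normal component of the ambient derivative D_X' Y' of local
   extensions X', Y' of X, Y; this determines h on vector fields of S. *)
Definition second_fundamental_form (D : field M -> field M -> field M)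
    (h : field S -> field S -> S -> functional M) : Prop :=
  forall X Y p X' Y', vector_field X -> vector_field Y ->
    local_extension p X X' -> local_extension p Y Y' ->
    h X Y p = normal_part p (D X' Y' (iota p)).

Definition mean_curvature_vector
    (h : field S -> field S -> S -> functional M) (H : S -> functional M) :
    Prop :=
  forall p (E : 'I_m -> field S), (forall k, vector_field (E k)) ->
    (forall k l, induced_metric p (E k p) (E l p) = (k == l)%:R) ->
    H p = m%:R^-1 *: \sum_k h (E k) (E k) p.

Definition totally_umbilical
    (h : field S -> field S -> S -> functional M) (H : S -> functional M) :
    Prop :=
  forall Z W p, vector_field Z -> vector_field W ->
    h Z W p = induced_metric p (Z p) (W p) *: H p.

Definition totally_geodesic (h : field S -> field S -> S -> functional M) :
    Prop :=
  forall Z W p, vector_field Z -> vector_field W -> h Z W p = 0.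

Variables (phi : M -> functional M -> functional M) (xi : field M).

(* xi restricts to a section of the tangent bundle of S. *)
Definition tangent_to_submanifold : Prop :=
  exists2 xiS : field S, vector_field xiS &
    forall p, tangent_map (xiS p) = xi (iota p).

(* phi X = T X + N X, for X tangent to S. *)
Definition T_part (p : S) (v : functional S) : functional S :=
  tangential_part p (phi (iota p) (tangent_map v)).

Definition N_part (p : S) (v : functional S) : functional M :=
  normal_part p (phi (iota p) (tangent_map v)).

Record PAInv_submanifold (D Dperp : tangent_distribution S) : Prop := {
  painv_immersion : immersion;
  painv_xi : tangent_to_submanifold;
  painv_orth : forall p v w, D p v -> Dperp p w -> induced_metric p v w = 0;
  painv_orth_xi : forall p v, D p v \/ Dperp p v ->
    g (iota p) (tangent_map v) (xi (iota p)) = 0;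
  painv_split : forall p v, tangent p v ->
    exists u w (a : R), [/\ D p u, Dperp p w &
      tangent_map v = tangent_map u + tangent_map w + a *: xi (iota p)];
  painv_anti_invariant : forall p w, Dperp p w ->
    normal p (phi (iota p) (tangent_map w));
  painv_T : forall p v, D p v -> D p (T_part p v)
}.

Definition phi_image (Dperp : tangent_distribution S) (p : S) : set (functional M) :=
  [set phi (iota p) (tangent_map w) | w in Dperp p].

Definition N_image (D : tangent_distribution S) (p : S) : set (functional M) :=
  [set N_part p v | v in D p].

Definition mu (D Dperp : tangent_distribution S) (p : S) : set (functional M) :=
  [set w | normal p w /\
    forall u, phi_image Dperp p u \/ N_image D p u -> g (iota p) w u = 0].

Definition N_image_plus_mu (D Dperp : tangent_distribution S) (p : S) :
    set (functional M) :=
  [set u + w | u in N_image D p & w in mu D Dperp p].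

End Submanifolds.

(* Sections along S of a family of subspaces of the ambient tangent spaces;
   used for the mean curvature vector. *)
Definition section_of (R : realType) (m n : nat) (S : manifold R m)
    (M : manifold R n) (V : S -> set (functional M)) (H : S -> functional M) :
    Prop :=
  forall p, V p (H p).

(* Main.v *)
Require Import Defs.
From mathcomp Require Import all_boot all_order all_algebra.
From mathcomp Require Import all_classical all_reals all_analysis.

(** The first alternative always holds. In a Kenmotsu manifold the structure
    vector field is geodesic: nabla_X xi = X - eta(X) xi, so nabla_xi xi = 0
    ([kenmotsu_xi_geodesic]). As xi is tangent to S and extends its own
    restriction to S, this gives h(xi, xi) = (nabla_xi xi)^normal = 0, while
    umbilicity gives h(xi, xi) = g(xi, xi) H = H because xi is a unit vector.
    Hence H = 0, and h = g H vanishes identically. *)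

Set Implicit Arguments.
Unset Strict Implicit.
Unset Printing Implicit Defensive.

Import Order.TTheory GRing.Theory Num.Theory.

Local Open Scope ring_scope.

Section TangentVectors.
Variables (R : realType) (n : nat) (M : manifold R n).
Implicit Types (p : M) (v w : functional M).

Lemma tangent0 p : tangent p (0 : functional M).
Proof.
by split=> [f _|a f f' _ _|f f' _ _] //; rewrite /= !mulr0 addr0.
Qed.

Lemma tangentN p v : tangent p v -> tangent p (- v).
Proof.
case=> voff vlin vleib; split=> [f nf|a f f' sf sf'|f f' sf sf'] /=.
- by rewrite /GRing.opp /= voff // oppr0.
- by rewrite /GRing.opp /= vlin // opprD mulrN.
- by rewrite /GRing.opp /= vleib // opprD !mulrN.
Qed.

(** Whether or not the constant 1 belongs to the algebra of smooth functions:
    inside it Leibniz on 1 = 1 * 1 applies, outside it [v] vanishes by the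
    encoding of tangent vectors. *)
Lemma tangent_one p v : tangent p v -> v (fun=> 1) = 0.
Proof.
case=> voff _ vleib.
have [s1|/voff//] := pselect (smooth_fun (fun _ : M => 1 : R)).
have := vleib _ _ s1 s1; rewrite mulr1 mul1r => /eqP.
by rewrite -subr_eq0 opprD addrA subrr sub0r oppr_eq0 => /eqP.
Qed.

Variable g : M -> functional M -> functional M -> R.
Hypothesis gR : riemannian_metric g.

Lemma metric0l p w : tangent p w -> g p 0 w = 0.
Proof.
move=> tw; have := riem_linear gR 1 (tangent0 p) (tangent0 p) tw.
rewrite scaler0 addr0 mul1r => /eqP.
by rewrite -subr_eq0 opprD addrA subrr sub0r oppr_eq0 => /eqP.
Qed.

Lemma metricNl p v w : tangent p v -> tangent p w -> g p (- v) w = - g p v w.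
Proof.
move=> tv tw; have := riem_linear gR (-1) tv (tangent0 p) tw.
by rewrite scaleN1r addr0 mulN1r (metric0l tw) addr0.
Qed.

Lemma metric_eq0 p v : tangent p v -> g p v v = 0 -> v = 0.
Proof.
move=> tv gv0; apply: contrapT => v0.
by have := riem_pos gR tv v0; rewrite gv0 ltxx.
Qed.

End TangentVectors.

Section KenmotsuStructureField.
Variables (R : realType) (n : nat) (M : manifold R (2 * n).+1).
Variables (phi : M -> functional M -> functional M) (xi : field M).
Variables (eta : M -> functional M -> R).
Variable g : M -> functional M -> functional M -> R.

Lemma xi_unit : almost_contact_metric phi xi eta g ->
  forall p, g p (xi p) (xi p) = 1.
Proof.
move=> A p; have txi := (acm_xi A).1 p.
have := acm_compat A txi txi.
rewrite (acm_phi_xi A) (acm_eta_xi A) (metric0l (acm_g A) (tangent0 p)) mulr1.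
by move=> /esym/eqP; rewrite subr_eq0 => /eqP.
Qed.

Lemma eta_metric : almost_contact_metric phi xi eta g ->
  forall p v, tangent p v -> eta p v = g p v (xi p).
Proof.
move=> A p v tv; have txi := (acm_xi A).1 p.
have tphi := endo_tangent (acm_phi A) tv.
have := acm_compat A txi tv.
rewrite (acm_phi_xi A) (acm_eta_xi A) (metric0l (acm_g A) tphi) mul1r.
by move=> /esym/eqP; rewrite subr_eq0 (riem_sym (acm_g A) txi tv) => /eqP.
Qed.

Variable nabla : field M -> field M -> field M.

(** The structure equation at X = Y = xi says that phi kills nabla_xi xi, and
    nabla_xi xi is orthogonal to xi because xi has constant length. On the
    orthogonal complement of xi, phi is an isometry. *)
Lemma kenmotsu_xi_geodesic : kenmotsu phi xi eta g nabla ->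
  forall p, nabla xi xi p = 0.
Proof.
move=> [A LC K] p; have vxi := acm_xi A; have txi := vxi.1 p.
have vphi := endo_smooth (acm_phi A) vxi.
have phi_xi0 : (fun q => phi q (xi q)) = (fun=> 0).
  by apply/funext => q; exact: acm_phi_xi A q.
have nabla0 : nabla xi (fun=> 0) p = 0.
  have v0 : vector_field (fun _ : M => 0 : functional M) by rewrite -phi_xi0.
  have /(congr1 (fun F : field M => F p)) /= := lc_additive LC vxi v0 v0.
  under [X in nabla xi X]funext do rewrite addr0.
  by move=> /eqP; rewrite -subr_eq0 opprD addrA subrr sub0r oppr_eq0 => /eqP.
set v := nabla xi xi p.
have tv : tangent p v := (lc_field LC vxi vxi).1 p.
have phiv : phi p v = 0.
  have := K xi xi p vxi vxi.
  rewrite phi_xi0 nabla0 (acm_phi_xi A) (metric0l (acm_g A) txi) scale0r.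
  by rewrite scaler0 subr0 sub0r => /eqP; rewrite oppr_eq0 => /eqP.
have gv : g p v (xi p) = 0.
  have := lc_metric LC p vxi vxi vxi.
  under [X in xi p X]funext do rewrite (xi_unit A).
  rewrite (tangent_one txi) (riem_sym (acm_g A) txi tv) -mulr2n.
  by move=> /esym/eqP; rewrite mulrn_eq0 /= => /eqP.
apply: (metric_eq0 (acm_g A) tv).
have := acm_compat A tv tv.
rewrite phiv (metric0l (acm_g A) (tangent0 p)) (eta_metric A tv) gv.
by rewrite mulr0 subr0.
Qed.

End KenmotsuStructureField.

Section NormalPart.
Variables (R : realType) (m n : nat) (S : manifold R m) (M : manifold R n).
Variables (iota : S -> M) (g : M -> functional M -> functional M -> R).
Hypothesis gR : riemannian_metric g.

Lemma tangent_map0 : tangent_map iota 0 = 0.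
Proof. by apply/funext => f; rewrite /tangent_map; case: ifP. Qed.

(** The tangential part [v] of 0 is chosen so that [- tangent_map v] is both
    normal and tangent to S, hence of zero length; if no choice is possible,
    the default value is [v = 0]. *)
Lemma normal_part0 (p : S) : normal_part iota g p 0 = 0.
Proof.
rewrite /normal_part /tangential_part.
case: xgetP => [v _ [tv [tw gw]]|_]; last by rewrite tangent_map0 subr0.
apply: (metric_eq0 gR tw).
have -> : g (iota p) (0 - tangent_map iota v) (0 - tangent_map iota v) =
          - g (iota p) (0 - tangent_map iota v) (tangent_map iota v).
  have tu : tangent (iota p) (tangent_map iota v).
    by have := tangentN tw; rewrite sub0r opprK.
  rewrite sub0r in tw *.
  by rewrite (riem_sym gR tw tu) -(metricNl gR tu tw).
by rewrite gw // oppr0.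
Qed.

(** Because H = g(X, X) H = h(X, X) = 0. *)
Lemma umbilical_totally_geodesic
    (h : field S -> field S -> S -> functional M) (H : S -> functional M)
    (X : field S) :
  totally_umbilical iota g h H -> vector_field X ->
  (forall p, induced_metric iota g p (X p) (X p) = 1) ->
  (forall p, h X X p = 0) -> totally_geodesic h.
Proof.
move=> umb vX unitX hX Z W p vZ vW.
have H0 : H p = 0 by rewrite -[H p]scale1r -(unitX p) -umb.
by rewrite umb // H0 scaler0.
Qed.

End NormalPart.

Theorem theorem9 (R : realType) (n m : nat)
    (M : manifold R (2 * n).+1) (S : manifold R m)
    (phi : M -> functional M -> functional M) (xi : field M)
    (eta : M -> functional M -> R)
    (g : M -> functional M -> functional M -> R)
    (nabla : field M -> field M -> field M) (c : R)
    (iota : S -> M) (D Dperp : tangent_distribution S)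
    (h : field S -> field S -> S -> functional M) (H : S -> functional M) :
  kenmotsu_space_form phi xi eta g nabla c ->
  PAInv_submanifold iota g phi xi D Dperp ->
  second_fundamental_form iota g nabla h ->
  mean_curvature_vector iota g h H ->
  totally_umbilical iota g h H ->
  totally_geodesic h \/
  section_of (N_image_plus_mu iota g phi D Dperp) H \/
  (section_of (phi_image iota phi Dperp) H -> rank Dperp = 1%N).
Proof.
move=> [K _] [_ [xiS vxiS xiSE] _ _ _ _ _] hsff _ umb; left.
have [A _ _] := K; have gR := acm_g A.
apply: (umbilical_totally_geodesic umb vxiS) => p.
  by rewrite /induced_metric xiSE; exact: xi_unit A _.
have ext : local_extension iota p xiS xi.
  by split; [exact: acm_xi A | apply: nearW => q; rewrite xiSE].
by rewrite (hsff xiS xiS p xi xi) // (kenmotsu_xi_geodesic K) normal_part0.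
Qed.
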